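(* Let $n\ge 1$, let $\bar x=(x_1,\dots,x_n)$, and let $\mathbb{C}[\bar x]^E$ be the E-polynomial ring in the variables $\bar x$ over the E-ring $(\mathbb{C},\exp)$. Then $\mathbb{C}[\bar x]^E$ does not satisfy the ascending chain condition for prime E-ideals; that is, there is an infinite strictly ascending chain $Q_0\subsetneq Q_1\subsetneq Q_2\subsetneq\cdots$ of prime E-ideals of $\mathbb{C}[\bar x]^E$.
   Context: An E-ring is a pair $(R,E)$ where $R$ is a commutative ring with $1$, assumed to be a $\mathbb{Q}$-algebra, and $E:(R,+)\to(R^*,\cdot)$ is a group homomorphism. An E-ideal of an E-ring $R$ is an ideal $I$ such that $\alpha\in I$ implies $E(\alpha)-1\in I$. An E-ideal is prime if it is prime as an ideal (the quotient ring is a domain). $\mathbb{C}$ is an E-ring with the usual exponential. E-polynomial ring $R[\bar x]^E$ over an E-ring $(R,E)$: put $R_{-1}=R$, $E_{-1}=E$, $R_0=R[\bar x]$, and let $A_0$ be the ideal of $R[\bar x]$ generated by $\bar x$, so $R_0=R_{-1}\oplus A_0$. Given $R_k=R_{k-1}\oplus A_k$, let $R_{k+1}=R_k[t^{A_k}]$ be the group ring over $R_k$ of a multiplicative copy $t^{A_k}$ of the additive group $A_k$, let $A_{k+1}$ be the $R_k$-submodule of $R_{k+1}$ generated by the $t^a$ with $0\ne a\in A_k$ (so $R_{k+1}=R_k\oplus A_{k+1}$), and define $E_k:(R_k,+)\to(R_{k+1}^*,\cdot)$ by $E_k(r+b)=E_{k-1}(r)\cdot t^b$ for $r\in R_{k-1}$,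 $b\in A_k$. Then $R[\bar x]^E=\bigcup_k R_k$, with exponential map $E=\bigcup_k E_k$. Equivalently, it is the free E-ring extension of $(R,E)$ on the generators $\bar x$. *)

(* Defs.v *)
From HB Require Import structures.
From mathcomp Require Import all_boot all_order all_algebra.
From mathcomp Require Import generic_quotient ring_quotient.
From mathcomp Require Import finmap ring.
From mathcomp Require Import boolp reals sequences exp trigo complex.
From mathcomp Require Import mpoly.
From mathcomp Require Import monalg.

Set Implicit Arguments.
Unset Strict Implicit.
Unset Printing Implicit Defensive.

Import GRing.Theory.

Local Open Scope ring_scope.
Local Open Scope quotient_scope.

(* [Eexp] takes values in the units because [Eexp x * Eexp (- x) = 1]; a      *)
(* Q-algebra structure on a ring is a (necessarily unique) ring morphism from *)
(* Q to the ring.                                                             *)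
HB.mixin Record ComNzRing_isERing R of GRing.ComNzRing R := {
  Eexp : R -> R;
  Eexp0 : Eexp 0 = 1;
  EexpD : {morph Eexp : x y / x + y >-> x * y};
  Erat : inhabited {rmorphism rat -> R}
}.

#[short(type="eRingType")]
HB.structure Definition ERing := {R of GRing.ComNzRing R & ComNzRing_isERing R}.

Lemma EexpN (R : eRingType) (x : R) : Eexp x * Eexp (- x) = 1.
Proof. by rewrite -EexpD subrr Eexp0. Qed.

Definition Eideal (R : eRingType) (I : {pred R}) : Prop :=
  [/\ 0 \in I,
      forall a, {in I &, forall u v, a * u + v \in I} &
      {in I, forall u, Eexp u - 1 \in I}].

(* [idealr_closed] includes properness: 1 is not in the ideal. *)
Definition prime_Eideal (R : eRingType) (I : {pred R}) : Prop :=
  [/\ Eideal I, idealr_closed I & prime_idealr_closed I].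

Section ComplexExp.
Variable R : realType.
Implicit Types z : R[i].
Local Open Scope complex_scope.

Definition cexp z : R[i] :=
  (expR (complex.Re z))%:C * (cos (complex.Im z) +i* sin (complex.Im z)).

Lemma cexp0 : cexp 0 = 1.
Proof. by rewrite /cexp /= expR0 cos0 sin0 mul1r. Qed.

Lemma cexpD : {morph cexp : x y / x + y >-> x * y}.
Proof.
case=> [a b] [c d]; rewrite /cexp /= expRD cosD sinD.
by apply/eqP; rewrite eq_complex /=; apply/andP; split; apply/eqP; ring.
Qed.

Lemma cexp_rat : inhabited {rmorphism rat -> R[i]}.
Proof. by constructor; exact: (@ratr R[i]). Qed.

HB.instance Definition _ := ComNzRing_isERing.Build R[i] cexp0 cexpD cexp_rat.
End ComplexExp.

(* The ring structure of [{malg R[K]}] requires a monoid [K] without          *)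
(* nontrivial units, so the product is redefined here for a group of          *)
(* exponents; the additive structure is that of [{malg R[A]}].                *)
Section GroupRing.
Local Open Scope fset.
Variables (R : comNzRingType) (A : zmodType).

Definition grpring : Type := {malg R[A]}.
HB.instance Definition _ := GRing.Zmodule.on grpring.

Implicit Types (f g h : grpring) (a b : A).

Definition grcoef f a : R := monalg.mcoeff a f.

(* the monomial c t^a *)
Definition grmon (c : R) a : grpring := << c *g a >>.

Definition grmul f g : grpring :=
  \sum_(a <- msupp f) \sum_(b <- msupp g)
    grmon (grcoef f a * grcoef g b) (a + b).

Lemma grmulw (d1 d2 : {fset A}) f g :
  msupp f `<=` d1 -> msupp g `<=` d2 ->
  grmul f g = \sum_(a <- d1) \sum_(b <- d2)
    grmon (grcoef f a * grcoef g b) (a + b).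
Proof.
move=> le1 le2; rewrite /grmul (big_fset_incl _ le1) /=.
  apply/eq_bigr=> a _; apply/big_fset_incl => // b _ bg.
  by rewrite /grcoef (mcoeff_outdom bg) mulr0 /grmon monalgU0.
move=> a _ af.
rewrite big1 => // b _.
by rewrite /grcoef (mcoeff_outdom af) mul0r /grmon monalgU0.
Qed.

Lemma grmulC : commutative grmul.
Proof.
move=> f g; rewrite /grmul exchange_big; apply/eq_bigr=> b _.
by apply/eq_bigr=> a _; rewrite mulrC addrC.
Qed.

Lemma grmul0 f : grmul 0 f = 0.
Proof. by rewrite /grmul msupp0 big_seq_fset0. Qed.

Lemma grmulDl : left_distributive grmul +%R.
Proof.
move=> f g h.
rewrite (grmulw (msuppD_le f g) (fsubset_refl _)).
rewrite (grmulw (fsubsetUl (msupp f) (msupp g)) (fsubset_refl (msupp h))).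
rewrite (grmulw (fsubsetUr (msupp f) (msupp g)) (fsubset_refl (msupp h))).
rewrite -big_split /=; apply/eq_bigr=> a _.
rewrite -big_split /=; apply/eq_bigr=> b _.
by rewrite /grcoef monalg.mcoeffD mulrDl /grmon monalgUD.
Qed.

Lemma grmulDr : right_distributive grmul +%R.
Proof. by move=> f g h; rewrite grmulC grmulDl !(grmulC f). Qed.

Lemma grmul_sum I (s : seq I) (F : I -> grpring) g :
  grmul (\sum_(i <- s) F i) g = \sum_(i <- s) grmul (F i) g.
Proof.
by rewrite (big_morph (grmul^~ g) (fun _ _ => grmulDl _ _ _) (grmul0 _)).
Qed.

Lemma grmonM c1 c2 a b :
  grmul (grmon c1 a) (grmon c2 b) = grmon (c1 * c2) (a + b).
Proof.
by rewrite (grmulw msuppU_le msuppU_le) !big_seq_fset1 /grcoef !mcoeffUU.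
Qed.

Lemma grmonE f : f = \sum_(a <- msupp f) grmon (grcoef f a) a.
Proof. exact: monalgE. Qed.

Lemma grmon_seq f : exists s : seq (R * A), f = \sum_(p <- s) grmon p.1 p.2.
Proof.
by exists [seq (grcoef f a, a) | a <- msupp f]; rewrite big_map; exact: grmonE.
Qed.

Lemma grmul_sumr I (s : seq I) (F : I -> grpring) f :
  grmul f (\sum_(i <- s) F i) = \sum_(i <- s) grmul f (F i).
Proof.
by rewrite grmulC grmul_sum; apply: eq_bigr => i _; rewrite grmulC.
Qed.

Lemma grmulA : associative grmul.
Proof.
move=> f g h.
have [s ->] := grmon_seq f; have [t ->] := grmon_seq g.
have [u ->] := grmon_seq h.
rewrite !grmul_sum; apply/eq_bigr=> a _.
rewrite grmul_sumr [X in grmul X _]grmul_sumr grmul_sum.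
apply/eq_bigr=> b _.
rewrite !grmul_sumr; apply/eq_bigr=> c _.
by rewrite !grmonM mulrA addrA.
Qed.

Lemma grmul1 : left_id (grmon 1 0) grmul.
Proof.
move=> f; have [s ->] := grmon_seq f; rewrite grmul_sumr.
by apply/eq_bigr=> a _; rewrite grmonM mul1r add0r.
Qed.

Lemma grmon1_neq0 : grmon 1 0 != 0.
Proof. by rewrite /grmon monalgU_eq0 oner_eq0. Qed.

HB.instance Definition _ := GRing.Zmodule_isComNzRing.Build grpring
  grmulA grmulC grmul1 grmulDl grmon1_neq0.

Definition grC (c : R) : grpring := grmon c 0.

Lemma grC_zmod : zmod_morphism grC.
Proof. by move=> c d; rewrite /grC /grmon monalgUB. Qed.

Lemma grC_monoid : monoid_morphism grC.
Proof. by split=> // c d; rewrite [RHS]grmonM addr0. Qed.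

HB.instance Definition _ := GRing.isZmodMorphism.Build R grpring grC grC_zmod.
HB.instance Definition _ :=
  GRing.isMonoidMorphism.Build R grpring grC grC_monoid.

Lemma grmonMr c1 c2 a b : grmon c1 a * grmon c2 b = grmon (c1 * c2) (a + b).
Proof. exact: grmonM. Qed.

End GroupRing.

(* The limit of R_0 -> R_1 -> R_2 -> ... is the ring of the sequences         *)
(* (u_k in R_k)_k such that u_k.+1 is the image of u_k for all large k,       *)
(* modulo the ideal of the sequences that vanish for all large k; an element  *)
(* x of R_k is represented by any sequence ending with x and its successive   *)
(* images.                                                                    *)
Section DirectLimit.
Variables (R : nat -> comNzRingType) (f : forall k, {rmorphism R k -> R k.+1}).

Definition rseq : Type := forall k, R k.

HB.instance Definition _ := gen_eqMixin rseq.
HB.instance Definition _ := gen_choiceMixin rseq.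

Implicit Types u v w : rseq.

Definition rseq_zero : rseq := fun k => 0.
Definition rseq_opp u : rseq := fun k => - u k.
Definition rseq_add u v : rseq := fun k => u k + v k.
Definition rseq_one : rseq := fun k => 1.
Definition rseq_mul u v : rseq := fun k => u k * v k.

Lemma rseq_ext u v : (forall k, u k = v k) -> u = v.
Proof. exact: functional_extensionality_dep. Qed.

Lemma rseq_addA : associative rseq_add.
Proof. by move=> u v w; apply: rseq_ext => k; apply: addrA. Qed.
Lemma rseq_addC : commutative rseq_add.
Proof. by move=> u v; apply: rseq_ext => k; apply: addrC. Qed.
Lemma rseq_add0 : left_id rseq_zero rseq_add.
Proof. by move=> u; apply: rseq_ext => k; apply: add0r. Qed.
Lemma rseq_addN : left_inverse rseq_zero rseq_opp rseq_add.
Proof. by move=> u; apply: rseq_ext => k; apply: addNr. Qed.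
Lemma rseq_mulA : associative rseq_mul.
Proof. by move=> u v w; apply: rseq_ext => k; apply: mulrA. Qed.
Lemma rseq_mulC : commutative rseq_mul.
Proof. by move=> u v; apply: rseq_ext => k; apply: mulrC. Qed.
Lemma rseq_mul1 : left_id rseq_one rseq_mul.
Proof. by move=> u; apply: rseq_ext => k; apply: mul1r. Qed.
Lemma rseq_mulDl : left_distributive rseq_mul rseq_add.
Proof. by move=> u v w; apply: rseq_ext => k; apply: mulrDl. Qed.
Lemma rseq_1neq0 : rseq_one != rseq_zero.
Proof.
by apply/eqP => /(congr1 (fun u : rseq => u 0%N)) /eqP; rewrite oner_eq0.
Qed.

HB.instance Definition _ := GRing.isZmodule.Build rseq
  rseq_addA rseq_addC rseq_add0 rseq_addN.
HB.instance Definition _ := GRing.Zmodule_isComNzRing.Build rseq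
  rseq_mulA rseq_mulC rseq_mul1 rseq_mulDl rseq_1neq0.

Definition coherent : {pred rseq} := fun u =>
  `[< exists N, forall k, (N <= k)%N -> u k.+1 = f k (u k) >].

Lemma coherent_subring : subring_closed coherent.
Proof.
split=> [|u v|u v].
- by apply/asboolP; exists 0%N => k _; rewrite [RHS]rmorph1.
- move=> /asboolP[M uM] /asboolP[N vN]; apply/asboolP; exists (maxn M N) => k.
  rewrite geq_max => /andP[Mk Nk].
  by rewrite [LHS](_ : _ = u k.+1 - v k.+1)// uM// vN// -rmorphB.
- move=> /asboolP[M uM] /asboolP[N vN]; apply/asboolP; exists (maxn M N) => k.
  rewrite geq_max => /andP[Mk Nk].
  by rewrite [LHS](_ : _ = u k.+1 * v k.+1)// uM// vN// -rmorphM.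
Qed.

HB.instance Definition _ :=
  GRing.isSubringClosed.Build rseq coherent coherent_subring.

Record cseq := CSeq { cseq_val :> rseq; cseqP : cseq_val \in coherent }.
HB.instance Definition _ := [isSub for cseq_val].
HB.instance Definition _ := [Choice of cseq by <:].
HB.instance Definition _ := [SubChoice_isSubComNzRing of cseq by <:].

Definition null_seq : {pred cseq} := fun u : cseq =>
  `[< exists N, forall k, (N <= k)%N -> (u : rseq) k = 0 >].

Lemma null_seq_idealr : idealr_closed null_seq.
Proof.
split=> [||a u v].
- by apply/asboolP; exists 0%N.
- apply/asboolP => -[N /(_ N (leqnn N))] /eqP.
  by rewrite [X in X == _](_ : _ = 1) ?oner_eq0.
- move=> /asboolP[M uM] /asboolP[N vN]; apply/asboolP; exists (maxn M N) => k.
  rewrite geq_max => /andP[Mk Nk].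
  rewrite [LHS](_ : _ = (a : rseq) k * (u : rseq) k + (v : rseq) k)//.
  by rewrite uM// vN// mulr0 addr0.
Qed.

HB.instance Definition _ := isIdealr.Build cseq null_seq null_seq_idealr.

Definition dirlim : Type := {ideal_quot null_seq}.
HB.instance Definition _ := GRing.ComNzRing.on dirlim.

Definition germ (u : cseq) : dirlim := \pi_({ideal_quot null_seq}) u.

Lemma germ_zmod : zmod_morphism germ.
Proof. exact: pi_is_zmod_morphism. Qed.
Lemma germ_monoid : monoid_morphism germ.
Proof. exact: pi_is_monoid_morphism. Qed.
HB.instance Definition _ :=
  GRing.isZmodMorphism.Build cseq dirlim germ germ_zmod.
HB.instance Definition _ :=
  GRing.isMonoidMorphism.Build cseq dirlim germ germ_monoid.

Lemma germP (u v : cseq) :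
  germ u = germ v <->
  exists N, forall k, (N <= k)%N -> (u : rseq) k = (v : rseq) k.
Proof.
split=> [/eqP|[N uv]].
  rewrite /germ -Quotient.idealrBE => /asboolP[N uv]; exists N => k /uv uvk.
  by apply/eqP; rewrite -subr_eq0; apply/eqP.
apply/eqP; rewrite /germ -Quotient.idealrBE; apply/asboolP; exists N => k /uv.
by move=> uvk; rewrite [LHS](_ : _ = (u : rseq) k - (v : rseq) k)// uvk subrr.
Qed.

Lemma germ_surj (z : dirlim) : exists u : cseq, z = germ u.
Proof. by exists (repr (z : {ideal_quot null_seq})); rewrite /germ reprK. Qed.

Fixpoint const_seq (x : R 0%N) (k : nat) : R k :=
  if k is j.+1 then f j (const_seq x j) else x.

Lemma const_seq_coherent x : (const_seq x : rseq) \in coherent.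
Proof. by apply/asboolP; exists 0%N. Qed.

Definition lim_in (x : R 0%N) : dirlim := germ (CSeq (const_seq_coherent x)).

Lemma lim_in_zmod : zmod_morphism lim_in.
Proof.
move=> x y; rewrite /lim_in -rmorphB; apply/germP; exists 0%N => k _ /=.
by elim: k => [//|k IHk] /=; rewrite IHk [LHS]rmorphB.
Qed.

Lemma lim_in_monoid : monoid_morphism lim_in.
Proof.
split=> [|x y]; rewrite /lim_in -?rmorphM -?(rmorph1 germ).
  apply/germP; exists 0%N => k _ /=.
  by elim: k => [//|k IHk] /=; rewrite IHk [LHS]rmorph1.
apply/germP; exists 0%N => k _ /=.
by elim: k => [//|k IHk] /=; rewrite IHk [LHS]rmorphM.
Qed.

HB.instance Definition _ :=
  GRing.isZmodMorphism.Build (R 0%N) dirlim lim_in lim_in_zmod.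
HB.instance Definition _ :=
  GRing.isMonoidMorphism.Build (R 0%N) dirlim lim_in lim_in_monoid.

(* The union of a compatible family of maps e_k : R_k -> R_k.+1.              *)
Section Limit.
Variable e : forall k, R k -> R k.+1.
Hypothesis eE : forall k x, e (f k x) = f k.+1 (e x).

Definition lim_seq (u : rseq) : rseq :=
  fun k => if k is j.+1 then e (u j) else 0.

Lemma lim_seq_coherent (u : cseq) : lim_seq u \in coherent.
Proof.
have /asboolP[N uN] := cseqP u; apply/asboolP; exists N.+1 => -[//|k] /= Nk.
by rewrite uN// eE.
Qed.

Definition lim_map (z : dirlim) : dirlim :=
  germ (CSeq (lim_seq_coherent (repr (z : {ideal_quot null_seq})))).

Lemma lim_mapE (u : cseq) : lim_map (germ u) = germ (CSeq (lim_seq_coherent u)).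
Proof.
apply/germP; set v := repr _.
have /germP[N vu] : germ v = germ u by rewrite /germ reprK.
by exists N.+1 => -[//|k] /= Nk; rewrite vu.
Qed.

Hypothesis e0 : forall k, e (0 : R k) = 1.
Hypothesis eD : forall k, {morph @e k : x y / x + y >-> x * y}.

Lemma lim_map0 : lim_map 0 = 1.
Proof.
rewrite -(rmorph0 germ) lim_mapE -(rmorph1 germ); apply/germP.
by exists 1%N => -[//|k] _; apply: e0.
Qed.

Lemma lim_mapD : {morph lim_map : x y / x + y >-> x * y}.
Proof.
move=> x y; have [u ->] := germ_surj x; have [v ->] := germ_surj y.
rewrite -rmorphD !lim_mapE -rmorphM; apply/germP.
by exists 1%N => -[//|k] _; apply: eD.
Qed.

Lemma lim_map_in (x y : R 0%N) : e x = f 0%N y -> lim_map (lim_in x) = lim_in y.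
Proof.
move=> exy; rewrite lim_mapE; apply/germP; exists 1%N => -[//|k] _ /=.
by elim: k => [//|k IHk]; rewrite [LHS]eE IHk.
Qed.

End Limit.

End DirectLimit.

Section ZmodSub.
Variables (V : zmodType) (S : zmodClosed V).

Record zsub := ZSub { zsub_val : V; zsubP : zsub_val \in S }.
HB.instance Definition _ := [isSub for zsub_val].
HB.instance Definition _ := [Choice of zsub by <:].
HB.instance Definition _ := [SubChoice_isSubZmodule of zsub by <:].
End ZmodSub.

(* The data from which R_k.+1 and E_k are built: the ring R_k, the group A_k, *)
(* the projection [st_part] of R_k = R_k.-1 (+) A_k onto A_k, whose kernel is *)
(* R_k.-1, and the map [st_exp] sending r + b to E_k.-1(r) for r in R_k.-1    *)
(* and b in A_k.                                                              *)
Record stage := Stage {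
  st_ring : comNzRingType;
  st_sub : zmodClosed st_ring;
  st_part : {additive st_ring -> zsub st_sub};
  st_exp : st_ring -> st_ring;
  st_partK : forall b : zsub st_sub, st_part (zsub_val b) = b;
  st_expA : forall b : zsub st_sub, st_exp (zsub_val b) = 1;
  st_expD : {morph st_exp : x y / x + y >-> x * y}
}.

Section Next.
Variable s : stage.
Local Notation R := (st_ring s).
Local Notation A := (zsub (st_sub s)).
Local Notation R' := (grpring R A).

(* E_k : R_k -> R_k.+1, r + b |-> E_k.-1(r) t^b *)
Definition next_E (x : R) : R' := grmon (st_exp x) (st_part s x).

Lemma next_ED : {morph next_E : x y / x + y >-> x * y}.
Proof. by move=> x y; rewrite /next_E grmonMr st_expD raddfD. Qed.

Lemma next_E0 : next_E 0 = 1.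
Proof.
have val0 : zsub_val (0 : A) = 0 by exact: (raddf0 val).
by rewrite /next_E raddf0 -{1}val0 st_expA.
Qed.

(* A_k.+1, the R_k-submodule spanned by the t^a with a != 0 *)
Definition next_sub : {pred R'} := fun g =>
  `[< exists2 cs : seq (R * A), all (fun c => c.2 != 0) cs &
        g = \sum_(c <- cs) grmon c.1 c.2 >].

Lemma next_sub_zmod : zmod_closed next_sub.
Proof.
split=> [|g h].
  by apply/asboolP; exists [::] => //; rewrite big_nil.
move=> /asboolP[cs cs0 ->] /asboolP[ds ds0 ->]; apply/asboolP.
exists (cs ++ [seq (- d.1, d.2) | d <- ds]).
  by rewrite all_cat cs0 all_map.
rewrite big_cat big_map; congr (_ + _); rewrite -sumrN.
by apply: eq_bigr => d _; rewrite /grmon monalgUN.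
Qed.

HB.instance Definition _ := GRing.isZmodClosed.Build R' next_sub next_sub_zmod.

Lemma next_subE (g : R') : (g \in next_sub) = (grcoef g 0 == 0).
Proof.
apply/asboolP/eqP => [[cs cs0 ->]|g0].
  rewrite /grcoef raddf_sum big_seq big1// => c /(allP cs0) c0.
  by rewrite /= mcoeffU (negbTE c0).
exists [seq (grcoef g a, a) | a <- msupp g]; last first.
  by rewrite big_map; apply: grmonE.
apply/allP => _ /mapP[a ag ->] /=; apply: contraTneq ag => ->.
by rewrite -mcoeff_neq0 -/(grcoef g 0) g0 eqxx.
Qed.

Lemma next_part_in (g : R') : g - grC A (grcoef g 0) \in next_sub.
Proof.
by rewrite next_subE /grcoef mcoeffB mcoeffU eqxx subrr.
Qed.

Definition next_part (g : R') : zsub next_sub := ZSub (next_part_in g).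

Lemma next_part_zmod : zmod_morphism next_part.
Proof.
move=> g h; apply: val_inj; rewrite raddfB /= /grcoef mcoeffB raddfB.
by rewrite !opprD !opprK -!addrA; congr (_ + _); rewrite addrCA.
Qed.

HB.instance Definition _ :=
  GRing.isZmodMorphism.Build R' (zsub next_sub) next_part next_part_zmod.

Definition next_exp (g : R') : R' := next_E (grcoef g 0).

Lemma next_partK (b : zsub next_sub) : next_part (zsub_val b) = b.
Proof.
apply: val_inj => /=; have := zsubP b; rewrite next_subE => /eqP ->.
by rewrite raddf0 subr0.
Qed.

Lemma next_expA (b : zsub next_sub) : next_exp (zsub_val b) = 1.
Proof.
by have := zsubP b; rewrite next_subE /next_exp => /eqP ->; exact: next_E0.
Qed.

Lemma next_expD : {morph next_exp : x y / x + y >-> x * y}.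
Proof. by move=> x y; rewrite /next_exp /grcoef mcoeffD next_ED. Qed.

Definition next_stage : stage := Stage next_partK next_expA next_expD.
End Next.

Section Epoly.
Variables (R : eRingType) (n : nat).
Local Notation R0 := {mpoly R[n]}.
Local Notation coef0 := (@mpoly.mcoeff n R 0%MM).

(* A_0, the ideal generated by the variables *)
Definition base_sub : {pred R0} := fun p =>
  `[< exists q : 'I_n -> R0, p = \sum_(i < n) q i * 'X_i >].

Lemma base_sub_zmod : zmod_closed base_sub.
Proof.
split=> [|g h].
  by apply/asboolP; exists (fun=> 0); rewrite big1// => i _; rewrite mul0r.
move=> /asboolP[q ->] /asboolP[r ->]; apply/asboolP.
exists (fun i => q i - r i); rewrite -sumrB.
by apply: eq_bigr => i _; rewrite mulrBl.
Qed.

HB.instance Definition _ := GRing.isZmodClosed.Build R0 base_sub base_sub_zmod.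

Lemma base_subE (p : R0) : (p \in base_sub) = (coef0 p == 0).
Proof.
apply/asboolP/eqP => [[q ->]|p0].
  rewrite raddf_sum big1// => i _.
  rewrite [LHS]((mcoeff0_is_multiplicative n R).1 (q i)) mpoly.mcoeffX mnm1_eq0.
  by rewrite mulr0.
suff: p \in base_sub by move=> /asboolP.
have addI (u v : R0) : u \in base_sub -> v \in base_sub -> u + v \in base_sub.
  exact: rpredD.
rewrite (mpolyE p) big_seq; elim/big_rec: _ => [|m u mp uI].
  exact: rpred0.
apply: addI => //; case: (pickP (fun i => m i != 0%N)) => [i mi|m0].
  pose q := mpoly.mcoeff m p *: 'X_[m - U_(i)].
  apply/asboolP; exists (fun j => if j == i then q else 0).
  rewrite (bigD1 i)//= eqxx big1 => [|j /negbTE ->]; last by rewrite mul0r.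
  by rewrite addr0 /q -scalerAl -mpolyXD submK// lep1mP.
have m00 : m = 0%MM.
  by apply/mnmP => i; rewrite mnm0E; apply/eqP; have /negbFE := m0 i.
by rewrite m00 [mpoly.mcoeff _ _]p0 scale0r rpred0.
Qed.

Lemma base_part_in (p : R0) : p - mpolyC n (coef0 p) \in base_sub.
Proof. by rewrite base_subE mpoly.mcoeffB mpoly.mcoeffC eqxx mulr1 subrr. Qed.

Definition base_part (p : R0) : zsub base_sub := ZSub (base_part_in p).

Lemma base_part_zmod : zmod_morphism base_part.
Proof.
move=> g h; apply: val_inj; rewrite raddfB /= mpoly.mcoeffB mpolyCB.
by rewrite !opprD !opprK -!addrA; congr (_ + _); rewrite addrCA.
Qed.

HB.instance Definition _ :=
  GRing.isZmodMorphism.Build R0 (zsub base_sub) base_part base_part_zmod.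

Definition base_exp (p : R0) : R0 := mpolyC n (Eexp (coef0 p)).

Lemma base_partK (b : zsub base_sub) : base_part (zsub_val b) = b.
Proof.
apply: val_inj => /=; have := zsubP b; rewrite base_subE => /eqP ->.
by rewrite mpolyC0 subr0.
Qed.

Lemma base_expA (b : zsub base_sub) : base_exp (zsub_val b) = 1.
Proof.
have := zsubP b; rewrite base_subE /base_exp => /eqP ->.
by rewrite Eexp0 mpolyC1.
Qed.

Lemma base_expD : {morph base_exp : x y / x + y >-> x * y}.
Proof.
by move=> x y; rewrite /base_exp mpoly.mcoeffD EexpD; exact: rmorphM.
Qed.

Definition base_stage : stage := Stage base_partK base_expA base_expD.

Fixpoint tower (k : nat) : stage :=
  if k is j.+1 then next_stage (tower j) else base_stage.

Definition tower_ring (k : nat) : comNzRingType := st_ring (tower k).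

Definition tower_in (k : nat) : {rmorphism tower_ring k -> tower_ring k.+1} :=
  @grC (tower_ring k) (zsub (st_sub (tower k))).

Definition tower_E (k : nat) : tower_ring k -> tower_ring k.+1 :=
  @next_E (tower k).

Lemma tower_E_in k (x : tower_ring k) :
  tower_E (tower_in k x) = tower_in k.+1 (tower_E x).
Proof.
rewrite /tower_E /= {1}/next_E /= /next_exp /grcoef mcoeffUU; congr grmon.
by apply: val_inj; rewrite /= /grcoef mcoeffUU subrr.
Qed.

Definition Epoly : Type := dirlim tower_in.
HB.instance Definition _ := GRing.ComNzRing.on Epoly.

Definition Epoly_exp : Epoly -> Epoly := lim_map tower_E_in.

Definition Epoly_in : R0 -> Epoly := lim_in tower_in.
HB.instance Definition _ := GRing.isZmodMorphism.Build R0 Epoly Epoly_in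
  (lim_in_zmod tower_in).
HB.instance Definition _ := GRing.isMonoidMorphism.Build R0 Epoly Epoly_in
  (lim_in_monoid tower_in).

Lemma Epoly_exp0 : Epoly_exp 0 = 1.
Proof. by apply: lim_map0 => k; apply: next_E0. Qed.

Lemma Epoly_expD : {morph Epoly_exp : x y / x + y >-> x * y}.
Proof. by apply: lim_mapD => k; apply: next_ED. Qed.

Lemma Epoly_rat : inhabited {rmorphism rat -> Epoly}.
Proof.
have [phi] := @Erat R.
pose c := [the {rmorphism R -> R0} of @mpolyC n R].
pose g := [the {rmorphism R0 -> Epoly} of Epoly_in].
by constructor; exact: [the {rmorphism rat -> Epoly} of g \o (c \o phi)].
Qed.

HB.instance Definition _ :=
  ComNzRing_isERing.Build Epoly Epoly_exp0 Epoly_expD Epoly_rat.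

Lemma Epoly_expC (c : R) :
  Eexp (Epoly_in (mpolyC n c)) = Epoly_in (mpolyC n (Eexp c)).
Proof.
apply: lim_map_in; rewrite /= /tower_E /next_E /= /base_exp.
rewrite mpoly.mcoeffC eqxx mulr1.
congr grmon; apply: val_inj; rewrite /= mpoly.mcoeffC eqxx mulr1 subrr.
by [].
Qed.

End Epoly.

(* Main.v *)
Require Import Defs.
From HB Require Import structures.
From mathcomp Require Import all_boot all_order all_algebra.
From mathcomp Require Import finmap boolp classical_sets reals complex mpoly.
From mathcomp Require monalg.

(** A prime E-ideal is the same thing as the kernel of an E-morphism to an
    E-ring that is a domain, so an ascending chain of prime E-ideals can be
    obtained from E-domains K_0 -> K_1 -> K_2 -> ... connected by E-morphisms,
    together with an E-morphism from C[x]^E to K_0: take for Q_k the kernel of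
    the composite map to K_k.

    The ring K_k ([Etrunc]) is C[X] made into an E-ring as freely as possible
    subject to E(c X^j) = 1 for 1 <= j <= k and every scalar c.  The single
    relation E(X) = 1 would not give a domain, since E(X) - 1 is the product of
    E(X/2) - 1 and E(X/2) + 1; relations holding on a divisible group of
    exponents leave a torsion-free quotient.  Concretely, K_k is
    the union of the tower of group rings that defines the E-polynomial ring,
    except that A_0 now consists of the polynomials divisible by X^(k+1), and
    C[X] is projected onto it by dropping the terms of degree at most k.

    Three facts carry the argument.
    - [grpring_domain]: the group ring over a domain of a torsion-free group is
      a domain.  Such a group carries a compatible total order
      ([total_cone], by Zorn), and then the leading terms of two nonzero
      elements multiply to the leading term of the product.  All the stages of
      the tower, and hence K_k, are therefore domains ([Etrunc_domain]).
    - [stage_universal]: the union of a tower is free over its first stage, so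
      that a ring morphism on the first stage that respects the values of E
      already prescribed there extends to an E-morphism.  This yields both
      C[x]^E -> K_0, sending every variable to X, and K_k -> K_(k+1), which is
      the identity on C[X].
    - [Etrunc_exp_low] and [Etrunc_exp_high]: E(X^(k+1)) is 1 in K_(k+1) but
      not in K_k, so E(x_1^(k+1)) - 1 lies in Q_(k+1) and not in Q_k. *)

Set Implicit Arguments.
Unset Strict Implicit.
Unset Printing Implicit Defensive.

Import GRing.Theory.

Local Open Scope ring_scope.

(** * Total orders on torsion-free groups *)

Definition torsion_free (V : zmodType) : Prop :=
  forall (x : V) m, x *+ m.+1 = 0 -> x = 0.

Section TotalCone.
Variable A : zmodType.
Implicit Types P : set A.

(** The set of the elements that are positive for a compatible partial order on
    [A]. Membership of 0 is left open so that the empty set is a cone, and with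
    it the union of an empty chain. *)
Definition cone P : Prop :=
  (forall x y, P x -> P y -> P (x + y)) /\
  (forall x, P x -> P (- x) -> x = 0).

Definition total P : Prop := forall x, P x \/ P (- x).

Let add0 P : set A := fun x => x = 0 \/ P x.

Let add0_cone P : cone P -> cone (add0 P).
Proof.
move=> [PD PN]; split=> [x y [->|Px] [->|Py]|x [//|Px] [/eqP|]].
- by left; rewrite addr0.
- by right; rewrite add0r.
- by right; rewrite addr0.
- by right; apply: PD.
- by rewrite oppr_eq0 => /eqP.
- exact: PN.
Qed.

Let add0_Mn P x m : cone (add0 P) -> add0 P x -> add0 P (x *+ m).
Proof.
move=> [PD _] Px; elim: m => [|m IHm]; first by left; rewrite mulr0n.
by rewrite mulrS; apply: PD.
Qed.

(** A maximal cone is total: if it could be enlarged neither by [x] nor by [-x],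
    it would contain a positive multiple of both, and [x] would be torsion. *)
Lemma total_cone : torsion_free A -> exists2 P, cone P & total P.
Proof.
move=> tfA.
have [F FP totF|C [coneC maxC]] := @Zorn_bigcup A cone.
  split=> [x y [X FX Xx] [Y FY Yy]|x [X FX Xx] [Y FY Yx]].
    have [XY|YX] := totF _ _ FX FY.
      by exists Y => //; apply: (FP Y FY).1 => //; apply: XY.
    by exists X => //; apply: (FP X FX).1 => //; apply: YX.
  have [XY|YX] := totF _ _ FX FY.
    by apply: (FP Y FY).2 => //; apply: XY.
  by apply: (FP X FX).2 => //; apply: YX.
have coneP := add0_cone coneC.
have [PD PN] := coneP.
have ext a : add0 C a \/ exists m, add0 C (- (a *+ m.+1)).
  apply: contrapT => /not_orP[nCa nCma].
  pose B : set A := fun x => exists c k, add0 C c /\ x = c + a *+ k.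
  have CB : (C `<` B)%classic.
    split=> [x Cx|BC].
      by exists x, 0%N; split; [right|rewrite mulr0n addr0].
    apply: nCa; right; apply: BC; exists 0, 1%N.
    by split; [left|rewrite mulr1n add0r].
  apply: (maxC B CB); split=> [_ _ [c [k [Cc ->]]] [d [l [Cd ->]]]|].
    by exists (c + d), (k + l)%N; split; [apply: PD|rewrite mulrnDr addrACA].
  move=> x [c [k [Cc xE]]] [d [l [Cd NxE]]].
  have cd0 : (c + d) + a *+ (k + l) = 0.
    by rewrite mulrnDr addrACA -xE -NxE subrr.
  case klE: (k + l)%N => [|m].
    have /eqP := klE; rewrite addn_eq0 => /andP[/eqP k0 /eqP l0].
    move: cd0 xE; rewrite k0 l0 !mulr0n !addr0 => cd0 ->.
    apply: PN => //; suff -> : - c = d by [].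
    by apply/eqP; rewrite eq_sym -addr_eq0 addrC; apply/eqP.
  case: nCma; exists m; rewrite -klE.
  by have -> : - (a *+ (k + l)) = c + d;
    [apply/eqP; rewrite eq_sym -addr_eq0; apply/eqP | apply: PD].
exists (add0 C) => // x.
have [|[m Cm]] := ext x; first by left.
have [|[l Cl]] := ext (- x); first by right.
left; left; apply: (tfA _ (m.+1 * l.+1).-1); rewrite prednK//.
move: Cl; rewrite mulNrn opprK => Cl; apply: PN.
  by rewrite mulnC mulrnA; apply: add0_Mn.
by rewrite mulrnA -mulNrn; apply: add0_Mn.
Qed.

Lemma cone_max P (s : seq A) : cone P -> total P -> s != [::] ->
  exists2 a, a \in s & forall b, b \in s -> P (a - b).
Proof.
move=> [PD _] totP; elim: s => [//|c s IHs] _.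
have P0 : P 0 by case: (totP 0) => //; rewrite oppr0.
have [-> | /IHs[a sa amax]] := eqVneq s [::].
  by exists c => [|b]; rewrite mem_seq1 // => /eqP ->; rewrite subrr.
have [Pac|] := totP (a - c).
  exists a => [|b]; first by rewrite inE sa orbT.
  by rewrite inE => /orP[/eqP -> //|/amax].
rewrite opprB => Pca; exists c => [|b]; first by rewrite mem_head.
rewrite inE => /orP[/eqP ->|/amax Pab]; first by rewrite subrr.
by rewrite -(subrKA a); apply: PD.
Qed.
End TotalCone.

(** * Group rings of torsion-free groups *)

Lemma grC_inj (R : comNzRingType) (A : zmodType) : injective (@grC R A).
Proof.
move=> c d /(congr1 (fun g => grcoef g 0)).
by rewrite /grcoef [LHS]monalg.mcoeffUU [RHS]monalg.mcoeffUU.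
Qed.

Section GroupRingDomain.
Import monalg.
Local Open Scope fset_scope.
Variables (R : comNzRingType) (A : zmodType).
Local Notation G := (grpring R A).

Lemma grpring_torsion_free : torsion_free R -> torsion_free G.
Proof.
move=> tfR f m fm; apply/malgP => a; rewrite mcoeff0.
by apply: (tfR _ m); rewrite -monalg.mcoeffMn [f *+ _]fm mcoeff0.
Qed.

(** The coefficient of [f * g] at the sum [a + b] of the largest exponents is
    the product of the two leading coefficients, because no other pair of
    exponents in the supports has that sum. *)
Lemma grpring_domain : torsion_free A ->
  GRing.integral_domain_axiom R -> GRing.integral_domain_axiom G.
Proof.
move=> tfA domR f g; apply: contra_eqT; rewrite negb_or => /andP[f0 g0].
have [P coneP totP] := total_cone tfA; have [PD PN] := coneP.
have supp0 (h : G) : h != 0 -> enum_fset (monalg.msupp h) != [::].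
  apply: contraNneq => hs; apply/eqP/malgP => x; rewrite mcoeff0.
  by apply: mcoeff_outdom; rewrite -[_ \in _]/(x \in enum_fset _) hs.
have [a fa amax] := cone_max coneP totP (supp0 f f0).
have [b gb bmax] := cone_max coneP totP (supp0 g g0).
suff fgE : grcoef (f * g) (a + b) = grcoef f a * grcoef g b.
  apply: contraTneq isT => fg0; move: fgE; rewrite fg0 /grcoef mcoeff0.
  move=> /esym/domR; rewrite !mcoeff_eq0.
  by rewrite -[_ \in _]/(a \in enum_fset _) fa gb.
rewrite /grcoef [f * g]/(grmul f g) !raddf_sum (big_fsetD1 a fa) /=.
rewrite raddf_sum (big_fsetD1 b gb) /= mcoeffUU !big1_seq ?addr0 //.
  move=> c /andP[_]; rewrite in_fsetD1 => /andP[ca fc].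
  rewrite raddf_sum big1_seq // => d /andP[_ gd].
  rewrite /= monalg.mcoeffU; case: eqP => // cdE; case/eqP: ca.
  (* Here a - c and b - d are both nonnegative, and their sum is 0. *)
  apply/eqP; rewrite eq_sym -subr_eq0; apply/eqP/PN; first exact: amax.
  have -> : - (a - c) = b - d; last exact: bmax.
  by apply/eqP; rewrite -subr_eq0 !opprB addrACA -opprD cdE subrr.
move=> d /andP[_]; rewrite in_fsetD1 => /andP[db gd].
by rewrite monalg.mcoeffU (inj_eq (addrI a)) (negbTE db).
Qed.
End GroupRingDomain.

Section ZsubVal.
Variables (V : zmodType) (S : zmodClosed V).

Lemma zsub_val0 : zsub_val (0 : zsub S) = 0.
Proof. exact: (raddf0 val). Qed.

Lemma zsub_valD : {morph @zsub_val V S : a b / a + b}.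
Proof. exact: (raddfD val). Qed.

Lemma zsub_valMn (a : zsub S) m : zsub_val (a *+ m) = zsub_val a *+ m.
Proof. exact: (raddfMn val). Qed.
End ZsubVal.

(** * Extending a ring morphism to a group ring by t^a |-> E(phi(a)) *)

Section ExpLift.
Import monalg.
Local Open Scope fset_scope.
Variables (R : comNzRingType) (S : zmodClosed R) (K : eRingType).
Variable phi : {rmorphism R -> K}.
Local Notation G := (grpring R (zsub S)).

Definition exp_lift (g : G) : K :=
  \sum_(a <- monalg.msupp g) phi (grcoef g a) * Eexp (phi (zsub_val a)).

Lemma exp_liftw (d : {fset zsub S}) (g : G) : monalg.msupp g `<=` d ->
  exp_lift g = \sum_(a <- d) phi (grcoef g a) * Eexp (phi (zsub_val a)).
Proof.
move=> gd; rewrite /exp_lift (big_fset_incl _ gd) //= => a _ ag.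
by rewrite /grcoef (mcoeff_outdom ag) rmorph0 mul0r.
Qed.

Lemma exp_lift_zmod : zmod_morphism exp_lift.
Proof.
move=> g h; rewrite (exp_liftw (monalg.msuppB_le g h)).
rewrite (exp_liftw (fsubsetUl (monalg.msupp g) (monalg.msupp h))).
rewrite (exp_liftw (fsubsetUr (monalg.msupp g) (monalg.msupp h))).
rewrite -sumrB; apply: eq_bigr => a _.
by rewrite /grcoef monalg.mcoeffB rmorphB mulrBl.
Qed.

HB.instance Definition _ :=
  GRing.isZmodMorphism.Build G K exp_lift exp_lift_zmod.

Lemma exp_lift_mon c (a : zsub S) :
  exp_lift (grmon c a) = phi c * Eexp (phi (zsub_val a)).
Proof.
by rewrite (exp_liftw monalg.msuppU_le) big_seq_fset1 /grcoef mcoeffUU.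
Qed.

Lemma exp_liftC c : exp_lift (grC _ c) = phi c.
Proof. by rewrite exp_lift_mon zsub_val0 rmorph0 Eexp0 mulr1. Qed.

Lemma exp_lift_monM c d (a b : zsub S) :
  exp_lift (grmon c a * grmon d b) =
  exp_lift (grmon c a) * exp_lift (grmon d b).
Proof.
rewrite [in LHS]grmonMr [LHS]exp_lift_mon.
rewrite [X in _ = X * _]exp_lift_mon [X in _ = _ * X]exp_lift_mon.
by rewrite zsub_valD rmorphM rmorphD EexpD mulrACA.
Qed.

Lemma exp_lift_monoid : monoid_morphism exp_lift.
Proof.
split=> [|g h]; first by rewrite [1]/(grC _ 1) exp_liftC rmorph1.
have [s ->] := grmon_seq g; have [t ->] := grmon_seq h.
rewrite mulr_suml !raddf_sum mulr_suml; apply: eq_bigr => a _ /=.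
rewrite mulr_sumr !raddf_sum mulr_sumr; apply: eq_bigr => b _ /=.
exact: exp_lift_monM.
Qed.

HB.instance Definition _ :=
  GRing.isMonoidMorphism.Build G K exp_lift exp_lift_monoid.
End ExpLift.

Section StageMorphism.
Variables (K : eRingType) (s : stage).
Implicit Types phi : {rmorphism st_ring s -> K}.

(** In a stage R_k = R_k.-1 (+) A_k the exponential is already prescribed on
    the summand R_k.-1, with values in R_k; this says that [phi] respects the
    prescribed values. *)
Definition exp_compat (phi : st_ring s -> K) : Prop :=
  forall x, phi (st_exp x) = Eexp (phi (x - zsub_val (st_part s x))).

Lemma exp_lift_E phi : exp_compat phi ->
  forall x, exp_lift phi (next_E x) = Eexp (phi x).
Proof.
by move=> phiE x; rewrite exp_lift_mon phiE -EexpD -rmorphD subrK.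
Qed.
End StageMorphism.

Lemma exp_lift_compat (K : eRingType) (s : stage)
    (phi : {rmorphism st_ring s -> K}) :
  exp_compat phi -> exp_compat (s := next_stage s) (exp_lift phi).
Proof.
move=> phiE g; rewrite [LHS](exp_lift_E phiE) /= opprB addrC subrK.
by rewrite exp_liftC.
Qed.

(** * Direct limits *)

Section DirectLimit.
Variables (R : nat -> comNzRingType) (f : forall k, {rmorphism R k -> R k.+1}).

Let coh (u : rseq R) N := forall k, (N <= k)%N -> u k.+1 = f k (u k).

Lemma dirlim_desc (K : comNzRingType) (phi : forall k, {rmorphism R k -> K}) :
    (forall k x, phi k.+1 (f k x) = phi k x) ->
  exists g : {rmorphism dirlim f -> K}, forall (u : cseq f) N,
    (forall k, (N <= k)%N -> (u : rseq R) k.+1 = f k ((u : rseq R) k)) ->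
    g (germ u) = phi N ((u : rseq R) N).
Proof.
move=> phi_in.
have coh_ge u N M : coh u N -> (N <= M)%N -> phi M (u M) = phi N (u N).
  move=> uN; elim: M => [|M IHM]; first by rewrite leqn0 => /eqP ->.
  rewrite leq_eqVlt => /predU1P[-> //|NM].
  by rewrite uN// phi_in IHM.
have coh_eq u v N M : coh u N -> coh v M ->
    (exists L, forall k, (L <= k)%N -> u k = v k) -> phi N (u N) = phi M (v M).
  move=> uN vM [L uv]; pose B := maxn L (maxn N M).
  rewrite -(coh_ge u N B uN) ?leq_max ?leqnn ?orbT//.
  by rewrite -(coh_ge v M B vM) ?leq_max ?leqnn ?orbT// uv// leq_maxl.
have /choice[idx cohP] (u : cseq f) : exists N, coh u N.
  exact/asboolP/(cseqP u).
have /choice[rep repP] := @germ_surj R f.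
pose g (z : dirlim f) : K := phi (idx (rep z)) ((rep z : rseq R) (idx (rep z))).
have gE (u : cseq f) N : coh u N -> g (germ u) = phi N ((u : rseq R) N).
  by move=> uN; apply: coh_eq => //; apply/germP; rewrite -repP.
have cohB (u v : cseq f) : coh (u - v) (maxn (idx u) (idx v)).
  move=> k; rewrite geq_max => /andP[uk vk].
  rewrite [LHS](_ : _ = (u : rseq R) k.+1 - (v : rseq R) k.+1)//.
  by rewrite !cohP// -rmorphB.
have cohM (u v : cseq f) : coh (u * v) (maxn (idx u) (idx v)).
  move=> k; rewrite geq_max => /andP[uk vk].
  rewrite [LHS](_ : _ = (u : rseq R) k.+1 * (v : rseq R) k.+1)//.
  by rewrite !cohP// -rmorphM.
have gB : zmod_morphism g.
  move=> x y; rewrite (repP x) (repP y) -rmorphB (gE _ _ (cohB _ _)).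
  set N := maxn _ _.
  rewrite (gE (rep x) N) ?(gE (rep y) N) -?rmorphB// => k.
  - by rewrite geq_max => /andP[_ /cohP].
  - by rewrite geq_max => /andP[/cohP].
have gM : monoid_morphism g.
  split=> [|x y].
    rewrite -(rmorph1 (@germ R f)) (gE _ 0%N) ?rmorph1// => k _.
    by rewrite [RHS]rmorph1.
  rewrite (repP x) (repP y) -rmorphM (gE _ _ (cohM _ _)).
  set N := maxn _ _.
  rewrite (gE (rep x) N) ?(gE (rep y) N) -?rmorphM// => k.
  - by rewrite geq_max => /andP[_ /cohP].
  - by rewrite geq_max => /andP[/cohP].
pose gZ := GRing.isZmodMorphism.Build _ _ g gB.
pose gMM := GRing.isMonoidMorphism.Build _ _ g gM.
by exists (HB.pack g gZ gMM : {rmorphism dirlim f -> K}).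
Qed.

Lemma dirlim_domain :
  (forall k, GRing.integral_domain_axiom (R k)) -> (forall k, injective (f k)) ->
  GRing.integral_domain_axiom (dirlim f).
Proof.
move=> dom finj x y.
have [u ->] := germ_surj x; have [v ->] := germ_surj y.
rewrite -rmorphM -(rmorph0 (@germ R f)) => /germP[N uv0].
have /asboolP[L uL] := cseqP u; have /asboolP[M vM] := cseqP v.
pose B := maxn N (maxn L M).
have tail (w : cseq f) W : coh w W -> (W <= B)%N -> (w : rseq R) B = 0 ->
    germ w = germ 0.
  move=> wW WB wB; apply/germP; exists B; elim=> [|k IHk].
    by rewrite leqn0 => /eqP <-.
  rewrite leq_eqVlt => /predU1P[<- //|Bk].
  by rewrite wW ?(leq_trans WB)// IHk// [LHS]rmorph0.
have /dom/orP[/eqP uB|/eqP vB] : (u : rseq R) B * (v : rseq R) B = 0.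
- exact: (uv0 B (leq_maxl _ _)).
- by rewrite (tail u L) ?eqxx// !leq_max leqnn orbT.
- by rewrite (tail v M) ?eqxx ?orbT// !leq_max leqnn !orbT.
Qed.
End DirectLimit.

(** * The E-ring freely generated by a stage *)

(** The construction of the E-polynomial ring, started from an arbitrary stage:
    [tower R n] is the case [s = base_stage R n]. *)
Section StageTower.
Variable s : stage.

Fixpoint stage_tower (k : nat) : stage :=
  if k is j.+1 then next_stage (stage_tower j) else s.

Definition stage_ring (k : nat) : comNzRingType := st_ring (stage_tower k).

Definition stage_in (k : nat) : {rmorphism stage_ring k -> stage_ring k.+1} :=
  @grC (stage_ring k) (zsub (st_sub (stage_tower k))).

Definition stage_E (k : nat) : stage_ring k -> stage_ring k.+1 :=
  @next_E (stage_tower k).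

Lemma stage_E_in k (x : stage_ring k) :
  stage_E (stage_in k x) = stage_in k.+1 (stage_E x).
Proof.
rewrite /stage_E /= {1}/next_E /= /next_exp /grcoef monalg.mcoeffUU.
by congr grmon; apply: val_inj; rewrite /= /grcoef monalg.mcoeffUU subrr.
Qed.

Lemma stage_lim_exp_in (x : st_ring s) : st_part s x = 0 ->
  lim_map stage_E_in (lim_in stage_in x) = lim_in stage_in (st_exp x).
Proof. by move=> x0; apply: lim_map_in; rewrite /= /stage_E /next_E x0. Qed.

(** A monomial c t^a with a != 0 does not come from the coefficient ring, so
    the only exponentials that stay in the first stage are the prescribed ones. *)
Lemma stage_exp_in_part (x y : st_ring s) :
  lim_map stage_E_in (lim_in stage_in x) = lim_in stage_in y ->
  st_part s x = 0.
Proof.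
rewrite lim_mapE => /germP[N /(_ N.+1 (leqnSn N))].
rewrite [LHS]/= -/(stage_E _) => EN.
have {EN} Exy : stage_E (const_seq stage_in x N) = const_seq stage_in y N.+1.
  exact: EN.
have {Exy} : next_E x = grC _ y.
  elim: N Exy => [//|N IHN] Exy; apply: IHN.
  apply: (@grC_inj _ (zsub (st_sub (stage_tower N.+1)))).
  by rewrite -[LHS]/(stage_in N.+1 _) -stage_E_in; exact: Exy.
move=> /(congr1 (fun g => grcoef g (st_part s x))).
rewrite /grcoef [LHS]monalg.mcoeffUU monalg.mcoeffU.
case: eqP => [-> //|_] expx0.
have : st_exp x * st_exp (- x) = 1.
  by rewrite -st_expD subrr -(zsub_val0 (st_sub s)) st_expA.
by rewrite expx0 mul0r => /esym/eqP; rewrite oner_eq0.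
Qed.

Section Universal.
Variables (K : eRingType) (phi : {rmorphism st_ring s -> K}).

Fixpoint stage_lift k : {rmorphism stage_ring k -> K} :=
  if k is j.+1 then exp_lift (stage_lift j) else phi.

Hypothesis phiE : exp_compat phi.

Lemma stage_lift_compat k : exp_compat (s := stage_tower k) (stage_lift k).
Proof. by elim: k => [|k IHk] //; apply: exp_lift_compat. Qed.

(** The morphism is forced at each step: R_k.+1 is generated over R_k by the
    t^a = E(a), which have to go to the exponential of the image of a. *)
Theorem stage_universal :
  exists g : {rmorphism dirlim stage_in -> K},
    (forall x, g (lim_in stage_in x) = phi x) /\
    (forall z, g (lim_map stage_E_in z) = Eexp (g z)).
Proof.
have [g gE] := dirlim_desc (f := stage_in) (phi := stage_lift)
                           (fun k => @exp_liftC _ _ _ _).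
exists g; split=> [x|z]; first by rewrite (gE _ 0%N).
have [u ->] := germ_surj z; have /asboolP[N uN] := cseqP u.
rewrite lim_mapE (gE u N uN).
have EuN k : (N.+1 <= k)%N ->
    lim_seq stage_E u k.+1 = stage_in k (lim_seq stage_E u k).
  case: k => [|k] Nk; first by exfalso; rewrite ltn0 in Nk.
  change (stage_E ((u : rseq _) k.+1) =
          stage_in k.+1 (stage_E ((u : rseq _) k))).
  by rewrite (uN k Nk) stage_E_in.
rewrite (gE (CSeq (lim_seq_coherent stage_E_in u)) N.+1 EuN).
exact: (exp_lift_E (@stage_lift_compat N)).
Qed.
End Universal.

Lemma stage_ring_domain k :
  torsion_free (st_ring s) -> GRing.integral_domain_axiom (st_ring s) ->
  torsion_free (stage_ring k) /\ GRing.integral_domain_axiom (stage_ring k).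
Proof.
move=> tf dom; elim: k => [//|k [tfk domk]]; split.
  exact: grpring_torsion_free.
apply: grpring_domain => // a m am; apply: val_inj.
by apply: (tfk _ m); rewrite -zsub_valMn am zsub_val0.
Qed.

End StageTower.

(** * The E-domains in which E(c X^j) = 1 for 1 <= j <= k *)

Section TruncatedExp.
Variables (R : eRingType) (k : nat).

Definition trunc_sub : {pred {poly R}} := fun p => take_poly k.+1 p == 0.

Lemma trunc_sub_zmod : zmod_closed trunc_sub.
Proof.
split=> [|p q /eqP p0 /eqP q0]; first by rewrite unfold_in take_poly0r.
by rewrite unfold_in raddfB /= p0 q0 subrr.
Qed.

HB.instance Definition _ :=
  GRing.isZmodClosed.Build {poly R} trunc_sub trunc_sub_zmod.

Lemma trunc_part_in (p : {poly R}) : p - take_poly k.+1 p \in trunc_sub.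
Proof.
by rewrite unfold_in raddfB /= (take_poly_id (size_take_poly _ _)) subrr.
Qed.

Definition trunc_part (p : {poly R}) : zsub trunc_sub := ZSub (trunc_part_in p).

Lemma trunc_part_zmod : zmod_morphism trunc_part.
Proof.
move=> p q; apply: val_inj; rewrite raddfB /= raddfB /=.
by rewrite !opprD !opprK -!addrA; congr (_ + _); rewrite addrCA.
Qed.

HB.instance Definition _ := GRing.isZmodMorphism.Build
  {poly R} (zsub trunc_sub) trunc_part trunc_part_zmod.

Definition trunc_exp (p : {poly R}) : {poly R} := (Eexp p`_0)%:P.

Lemma trunc_partK (b : zsub trunc_sub) : trunc_part (zsub_val b) = b.
Proof. by apply: val_inj => /=; rewrite (eqP (zsubP b)) subr0. Qed.

Lemma trunc_expA (b : zsub trunc_sub) : trunc_exp (zsub_val b) = 1.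
Proof.
have /eqP/(congr1 (fun p : {poly R} => p`_0)) := zsubP b.
by rewrite coef_take_poly coef0 /trunc_exp /= => ->; rewrite Eexp0 polyC1.
Qed.

Lemma trunc_expD : {morph trunc_exp : p q / p + q >-> p * q}.
Proof. by move=> p q; rewrite /trunc_exp coefD EexpD polyCM. Qed.

(** The role of R_k.-1 is played by the polynomials of degree at most [k], on
    which the exponential is prescribed to see the constant term only. *)
Definition trunc_stage : stage := Stage trunc_partK trunc_expA trunc_expD.

Definition Etrunc : Type := dirlim (stage_in trunc_stage).
HB.instance Definition _ := GRing.ComNzRing.on Etrunc.

Definition Etrunc_exp : Etrunc -> Etrunc := lim_map (@stage_E_in trunc_stage).

Definition Etrunc_in : {poly R} -> Etrunc := lim_in (stage_in trunc_stage).
HB.instance Definition _ := GRing.isZmodMorphism.Build {poly R} Etrunc Etrunc_in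
  (lim_in_zmod (stage_in trunc_stage)).
HB.instance Definition _ := GRing.isMonoidMorphism.Build
  {poly R} Etrunc Etrunc_in (lim_in_monoid (stage_in trunc_stage)).

Lemma Etrunc_exp0 : Etrunc_exp 0 = 1.
Proof. by apply: lim_map0 => j; apply: next_E0. Qed.

Lemma Etrunc_expD : {morph Etrunc_exp : x y / x + y >-> x * y}.
Proof. by apply: lim_mapD => j; apply: next_ED. Qed.

Lemma Etrunc_rat : inhabited {rmorphism rat -> Etrunc}.
Proof.
have [phi] := @Erat R.
pose c := [the {rmorphism R -> {poly R}} of polyC].
pose g := [the {rmorphism {poly R} -> Etrunc} of Etrunc_in].
by constructor; exact: [the {rmorphism rat -> Etrunc} of g \o (c \o phi)].
Qed.

HB.instance Definition _ :=
  ComNzRing_isERing.Build Etrunc Etrunc_exp0 Etrunc_expD Etrunc_rat.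

Lemma Etrunc_exp_low (p : {poly R}) : (size p <= k.+1)%N ->
  Eexp (Etrunc_in p) = Etrunc_in (Eexp p`_0)%:P.
Proof.
move=> sp; apply: stage_lim_exp_in; apply: val_inj => /=.
by rewrite take_poly_id // subrr.
Qed.

Lemma Etrunc_exp_high : Eexp (Etrunc_in ('X^(k.+1))) != 1.
Proof.
rewrite -(rmorph1 Etrunc_in); apply/eqP => /stage_exp_in_part.
move=> /(congr1 (@zsub_val _ _)); rewrite zsub_val0 /= -['X^(k.+1)]mul1r.
rewrite take_polyMXn_0 subr0 mul1r => /eqP.
by rewrite -size_poly_eq0 size_polyXn.
Qed.

Theorem Etrunc_domain :
  torsion_free R -> GRing.integral_domain_axiom {poly R} ->
  GRing.integral_domain_axiom Etrunc.
Proof.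
move=> tfR domR; have tfP : torsion_free {poly R}.
  move=> p m pm; apply/polyP => i; rewrite coef0; apply: (tfR _ m).
  by rewrite -coefMn pm coef0.
apply: dirlim_domain => j; last exact: grC_inj.
exact: (@stage_ring_domain trunc_stage j tfP domR).2.
Qed.

End TruncatedExp.

(** * The chain of E-morphisms and their kernels *)

Definition exp_morph (S K : eRingType) (g : S -> K) : Prop :=
  forall z, g (Eexp z) = Eexp (g z).

Lemma prime_Eideal_ker (S K : eRingType) (g : {rmorphism S -> K}) :
  exp_morph g -> GRing.integral_domain_axiom K ->
  prime_Eideal (fun z => g z == 0).
Proof.
move=> gE domK; pose I : {pred S} := fun z => g z == 0; rewrite -/I.
have IE z : (z \in I) = (g z == 0) by [].
have I0 : 0 \in I by rewrite IE rmorph0.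
have ID a : {in I &, forall u v, a * u + v \in I}.
  move=> u v; rewrite !IE => /eqP u0 /eqP v0.
  by rewrite rmorphD rmorphM u0 v0 mulr0 addr0.
split; [split=> // u|split=> //|move=> u v]; rewrite !IE.
- by move=> /eqP u0; rewrite rmorphB rmorph1 gE u0 Eexp0 subrr.
- by rewrite rmorph1 oner_neq0.
- by rewrite rmorphM => /eqP/domK.
Qed.

Section Chain.
Variables (R : eRingType) (n : nat).

Lemma Etrunc_next k :
  exists2 g : {rmorphism Etrunc R k -> Etrunc R k.+1}, exp_morph g &
    forall p, g (Etrunc_in k p) = Etrunc_in k.+1 p.
Proof.
have [|g [gin gE]] := @stage_universal (trunc_stage R k) (Etrunc R k.+1)
                                       (@Etrunc_in R k.+1).
  move=> p /=; rewrite opprB addrC subrK Etrunc_exp_low ?coef_take_poly //.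
  exact: leq_trans (size_take_poly _ _) _.
by exists g.
Qed.

Definition diagonal (p : {mpoly R[n]}) : {poly R} := mmap polyC (fun=> 'X) p.

Lemma Epoly_to_Etrunc :
  exists2 g : {rmorphism Epoly R n -> Etrunc R 0}, exp_morph g &
    forall p, g (Epoly_in p) = Etrunc_in 0 (diagonal p).
Proof.
pose d := [the {rmorphism {mpoly R[n]} -> {poly R}} of mmap polyC (fun=> 'X)].
pose phi := [the {rmorphism {mpoly R[n]} -> Etrunc R 0} of @Etrunc_in R 0 \o d].
have [|g [gin gE]] := @stage_universal (base_stage R n) (Etrunc R 0) phi.
  move=> p /=; rewrite opprB addrC subrK !mmapC Etrunc_exp_low ?coefC //.
  exact: size_polyC_leq1.
exists (g : {rmorphism Epoly R n -> Etrunc R 0}); last exact: gin.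
move=> z; rewrite -gE; congr (g _).
(* The two limit maps differ only in the proof that E commutes with the
   inclusions of the tower. *)
rewrite [LHS]/(lim_map (@tower_E_in R n) z).
by rewrite (Prop_irrelevance (@tower_E_in R n) (@stage_E_in (base_stage R n))).
Qed.

Fixpoint Epoly_Etrunc k : {rmorphism Epoly R n -> Etrunc R k} :=
  if k is j.+1 then sval (cid2 (Etrunc_next j)) \o Epoly_Etrunc j
  else sval (cid2 Epoly_to_Etrunc).

Lemma Epoly_EtruncE k : exp_morph (Epoly_Etrunc k).
Proof.
elim: k => [|k IHk] z /=; first by case: cid2.
by rewrite IHk; case: cid2.
Qed.

Lemma Epoly_Etrunc_in k p :
  Epoly_Etrunc k (Epoly_in p) = Etrunc_in k (diagonal p).
Proof.
elim: k => [|k IHk] /=; first by case: cid2.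
by rewrite IHk; case: cid2.
Qed.
End Chain.

Lemma complex_torsion_free (R : realType) : torsion_free R[i].
Proof. by move=> x m /eqP; rewrite Num.Theory.mulrn_eq0 => /eqP. Qed.

Theorem theorem3p2 (R : realType) (n : nat) (hn : (1 <= n)%N) :
  exists Q : nat -> {pred Epoly R[i] n},
    (forall k, prime_Eideal (Q k)) /\
    (forall k, {subset Q k <= Q k.+1} /\ ~ {subset Q k.+1 <= Q k}).
Proof.
exists (fun k z => Epoly_Etrunc R[i] n k z == 0); split=> k.
  apply: prime_Eideal_ker; first exact: Epoly_EtruncE.
  apply: Etrunc_domain; first exact: complex_torsion_free.
  by move=> p q /eqP; rewrite mulf_eq0.
split=> [z|/(_ (Eexp (Epoly_in ('X_(Ordinal hn) ^+ k.+1)) - 1))].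
  by rewrite !unfold_in /= => /eqP ->; rewrite rmorph0.
have diagX : diagonal ('X_(Ordinal hn) ^+ k.+1 : {mpoly R[i][n]}) = 'X^(k.+1).
  by rewrite /diagonal rmorphXn /= mmapX mmap1U.
rewrite !unfold_in !rmorphB !rmorph1 !Epoly_EtruncE !Epoly_Etrunc_in diagX.
rewrite !subr_eq0 Etrunc_exp_low ?size_polyXn // coefXn Eexp0 rmorph1 eqxx.
by move=> /(_ isT); apply/negP/Etrunc_exp_high.
Qed.
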